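(* Consider the problem $$(\mathrm{CP})\qquad\inf_{\mathbf x\in\mathbb R^n}\{f(\mathbf x): g_i(\mathbf x)\le0,\ i=1,\dots,m\},$$ where $f=s_0+p_0$ and $g_i=s_i+p_i$ ($i=1,\dots,m$) are convex polynomials such that, for each $i=0,1,\dots,m$, $s_i(\mathbf x)=\sum_{j=1}^n u_i^j(x_j)$ with each $u_i^j$ a convex univariate polynomial in $x_j$ of degree at most $2d_j$, and $p_i$ is an SOS-convex polynomial of degree at most $2r$. Let $d_0:=\max_{1\le j\le n}d_j$ and assume $d_0>r$ and that $f$ is bounded from below on the feasible set $\mathbf F=\{\mathbf x: g_i(\mathbf x)\le0,\ i=1,\dots,m\}$. Assume there exists $\widehat{\mathbf x}\in\mathbf F$ with $g_i(\widehat{\mathbf x})<0$ for all $i=1,\dots,m$. Then, with the problems $(\mathrm D^{\mathrm{SPLD}}_{\mathrm{sos}})$ and $(\widetilde{\mathrm D}^{\mathrm{SPLD}}_{\mathrm{sos}})$ defined in the context, $$\mathrm{val}(\mathrm{CP})=\mathrm{val}(\mathrm D^{\mathrm{SPLD}}_{\mathrm{sos}})=\mathrm{val}(\widetilde{\mathrm D}^{\mathrm{SPLD}}_{\mathrm{sos}}),$$ and $(\mathrm D^{\mathrm{SPLD}}_{\mathrm{sos}})$ has an optimal solution.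
   Context: A polynomial is SOS-convex if its Hessian is an SOS matrix polynomial, i.e., $\nabla^2 p(\mathbf x)=F(\mathbf x)^TF(\mathbf x)$ for some matrix polynomial $F$. $\Sigma[\mathbf x]_r$: sums of squares of polynomials in $\mathbf x$ of degree $\le 2r$; $\Sigma[x_j]_{d}$: SOS univariate polynomials in $x_j$ of degree $\le 2d$. $\mathbb N^n_d=\{\boldsymbol\alpha\in\mathbb N^n:|\boldsymbol\alpha|\le d\}$; $\lceil\mathbf x\rceil_r=(\mathbf x^{\boldsymbol\alpha})_{\boldsymbol\alpha\in\mathbb N^n_r}$, of length $s(n,r)=\binom{n+r}{r}$; $\lceil x_j\rceil_{d}=(1,x_j,\dots,x_j^{d})^T$; $(M)_{\boldsymbol\alpha}$ is the coefficient matrix of $\mathbf x^{\boldsymbol\alpha}$ in a polynomial matrix $M$, and $h_{\boldsymbol\alpha}$ the coefficient of $\mathbf x^{\boldsymbol\alpha}$ in a polynomial $h$. $(\mathrm D^{\mathrm{SPLD}}_{\mathrm{sos}})$: maximize $\mu$ over $\mu\in\mathbb R$, $\lambda_i\ge0$ ($i=1,\dots,m$), $\sigma\in\Sigma[\mathbf x]_r$, $\sigma_j\in\Sigma[x_j]_{d_j}$ ($j=1,\dots,n$), subject to the polynomial identity $f+\sum_{i=1}^m\lambda_ig_i-\mu=\sigma+\sum_{j=1}^n\sigma_j$. $(\widetilde{\mathrm D}^{\mathrm{SPLD}}_{\mathrm{sos}})$: minimize $\sum_{\boldsymbol\alpha\in\mathbb N^n_{2d_0}}f_{\boldsymbol\alpha}y_{\boldsymbol\alpha}$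 over $\mathbf y=(y_{\boldsymbol\alpha})_{\boldsymbol\alpha\in\mathbb N^n_{2d_0}}\in\mathbb R^{s(n,2d_0)}$ subject to $\sum_{\boldsymbol\alpha\in\mathbb N^n_{2d_0}}(g_i)_{\boldsymbol\alpha}y_{\boldsymbol\alpha}\le0$, $i=1,\dots,m$; $\sum_{\boldsymbol\alpha\in\mathbb N^n_{2d_0}}y_{\boldsymbol\alpha}(\lceil x_j\rceil_{d_j}\lceil x_j\rceil_{d_j}^T)_{\boldsymbol\alpha}\succeq0$, $j=1,\dots,n$; $\sum_{\boldsymbol\alpha\in\mathbb N^n_{2d_0}}y_{\boldsymbol\alpha}(\lceil\mathbf x\rceil_r\lceil\mathbf x\rceil_r^T)_{\boldsymbol\alpha}\succeq0$; $y_{\mathbf 0}=1$. *)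

(* Defs.v *)
From HB Require Import structures.
From mathcomp Require Import all_boot all_order all_algebra.
From mathcomp Require Import reals.
From mathcomp Require Import mpoly.

Set Implicit Arguments.
Unset Strict Implicit.
Unset Printing Implicit Defensive.

Import Order.TTheory GRing.Theory Num.Theory.
Local Open Scope ring_scope.

Section Defs.
Context (R : realType) (n : nat).

(* total degree of p is at most k (msize p = 1 + degree, 0 for p = 0) *)
Definition mdeg_le (p : {mpoly R[n]}) (k : nat) : Prop := (msize p <= k.+1)%N.

Definition univ_emb (j : 'I_n) (q : {poly R}) : {mpoly R[n]} :=
  \sum_(k < size q) q`_k *: 'X_j ^+ k.

Definition sep_poly (u : 'I_n -> {poly R}) : {mpoly R[n]} :=
  \sum_(j < n) univ_emb j (u j).

Definition convex_fun (phi : ('I_n -> R) -> R) : Prop :=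
  forall (x y : 'I_n -> R) (t : R), 0 <= t -> t <= 1 ->
    phi (fun k => t * x k + (1 - t) * y k) <= t * phi x + (1 - t) * phi y.

Definition convex_upoly (q : {poly R}) : Prop :=
  forall (x y t : R), 0 <= t -> t <= 1 ->
    q.[t * x + (1 - t) * y] <= t * q.[x] + (1 - t) * q.[y].

Definition hessian (p : {mpoly R[n]}) : 'M[{mpoly R[n]}]_n :=
  \matrix_(i < n, j < n) mderiv i (mderiv j p).

Definition sos_convex (p : {mpoly R[n]}) : Prop :=
  exists (k : nat) (F : 'M[{mpoly R[n]}]_(k, n)), hessian p = F^T *m F.

Definition sos_mpoly (r : nat) (s : {mpoly R[n]}) : Prop :=
  exists (k : nat) (q : 'I_k -> {mpoly R[n]}),
    (forall i, mdeg_le (q i) r) /\ s = \sum_(i < k) q i ^+ 2.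

Definition sos_upoly (d : nat) (s : {poly R}) : Prop :=
  exists (k : nat) (q : 'I_k -> {poly R}),
    (forall i, (size (q i) <= d.+1)%N) /\ s = \sum_(i < k) q i ^+ 2.

Definition Lfun (D : nat) (y : 'X_{1..n < D} -> R) (h : {mpoly R[n]}) : R :=
  \sum_(a : 'X_{1..n < D}) h@_(bmnm a) * y a.

(* sum_alpha y_alpha (v v^T)_alpha  for a vector v of polynomials *)
Definition moment_mx (D : nat) (y : 'X_{1..n < D} -> R) (k : nat)
    (v : 'I_k -> {mpoly R[n]}) : 'M[R]_k :=
  \matrix_(a < k, b < k) Lfun y (v a * v b).

Definition mono_vec (r : nat) : 'I_#|{: 'X_{1..n < r.+1}}| -> {mpoly R[n]} :=
  fun i => 'X_[bmnm (enum_val i)].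

Definition var_pow_vec (j : 'I_n) (d : nat) : 'I_d.+1 -> {mpoly R[n]} :=
  fun a => 'X_j ^+ a.

End Defs.

Definition psd (R : realType) (k : nat) (A : 'M[R]_k) : Prop :=
  A^T = A /\ forall v : 'cV[R]_k, 0 <= (v^T *m A *m v) 0 0.

Definition is_inf (R : realType) (S : R -> Prop) (v : R) : Prop :=
  (forall z, S z -> v <= z) /\ (forall e, 0 < e -> exists z, S z /\ z < v + e).
Definition is_sup (R : realType) (S : R -> Prop) (v : R) : Prop :=
  (forall z, S z -> z <= v) /\ (forall e, 0 < e -> exists z, S z /\ v - e < z).

Section Problems.
Context (R : realType) (n m r : nat) (d : 'I_n -> nat)
        (f : {mpoly R[n]}) (g : 'I_m -> {mpoly R[n]}).

Definition d0 : nat := \max_(j < n) d j.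

Definition CP_feasible (x : 'I_n -> R) : Prop := forall i, (g i).@[x] <= 0.

Definition CP_values (z : R) : Prop :=
  exists x, CP_feasible x /\ z = f.@[x].

(* mu is the objective value of a feasible point of (D^SPLD_sos) *)
Definition D_feasible (mu : R) : Prop :=
  exists (lam : 'I_m -> R) (sigma : {mpoly R[n]}) (sig : 'I_n -> {poly R}),
    [/\ forall i, 0 <= lam i,
        sos_mpoly r sigma,
        forall j, sos_upoly (d j) (sig j) &
        f + \sum_(i < m) lam i *: g i - mpolyC n mu
          = sigma + \sum_(j < n) univ_emb j (sig j)].

(* objective values of feasible points of (tilde D^SPLD_sos);
   y is indexed by N^n_{2 d0} = monomials of degree < 2 d0 + 1 *)
Definition Dt_values (z : R) : Prop :=
  exists y : 'X_{1..n < (2 * d0).+1} -> R,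
    [/\ forall i, Lfun y (g i) <= 0,
        forall j, psd (moment_mx y (@var_pow_vec R n j (d j))),
        psd (moment_mx y (@mono_vec R n r)),
        y bm0 = 1 &
        z = Lfun y f].

End Problems.

(* Main.v *)
Require Import Defs.
From HB Require Import structures.
From mathcomp Require Import all_boot all_order all_algebra.
From mathcomp Require Import ring lra zify.
From mathcomp Require Import reals.
From mathcomp Require Import mpoly polyrcf.
From mathcomp Require Import boolp classical_sets filter topology normedtype derive.

(** Slater's condition gives multipliers [lam] for which the Lagrangian
    [L = f + sum lam_i g_i - v] is nonnegative, where [v] is the value of (CP).
    A convex polynomial that is bounded below attains its minimum, say at [a];
    translate [a] to the origin. The quadratic form of the Hessian of the
    SOS-convex part of [L] is a sum of squares, and so is its integral along
    segments from the origin, hence by Taylor's formula this part of [L] equals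
    its affine part plus a sum of squares of degree at most [2 r]. The affine
    part is absorbed by the univariate parts, which become convex and critical at
    the origin, hence nonnegative, hence sums of squares. So [v] is feasible for
    the SOS dual. The values of the moment problem contain those of (CP), by
    taking the moments of a point, and dominate those of the SOS dual. *)

Set Implicit Arguments.
Unset Strict Implicit.
Unset Printing Implicit Defensive.

Import Order.TTheory GRing.Theory Num.Theory numFieldNormedType.Exports.
Local Open Scope ring_scope.

Section RealInfima.
Context (R : realType).
Implicit Types (A B D S T : R -> Prop).

Lemma is_inf_exists S (c : R) :
  (exists z, S z) -> (forall z, S z -> c <= z) -> exists v, is_inf S v.
Proof.
move=> S_neq0 Sge; have infS : has_inf S by split=> //; exists c.
exists (inf S); split=> [|e /inf_adherent/(_ infS)[z Sz zlt]]; last by exists z.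
exact: (inf_lbound infS.2).
Qed.

Lemma separating_point A B :
  (exists a, A a) -> (exists b, B b) -> (forall a b, A a -> B b -> a <= b) ->
  exists s, (forall a, A a -> a <= s) /\ (forall b, B b -> s <= b).
Proof.
move=> A_neq0 [b0 Bb0] AB; exists (sup A); split=> [|b Bb].
  by apply: ub_le_sup; exists b0 => a Aa; exact: AB.
by apply: ge_sup => // a Aa; exact: AB.
Qed.

Lemma is_sup_is_inf_squeeze S T D v :
  is_inf S v -> (forall z, S z -> T z) ->
  (forall mu z, D mu -> T z -> mu <= z) -> D v -> is_sup D v /\ is_inf T v.
Proof.
move=> [_ Sapprox] ST DT Dv.
have Tapprox e : 0 < e -> exists z, T z /\ z < v + e.
  by move=> /Sapprox[z [/ST Tz zv]]; exists z.
split; split=> //.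
- move=> mu Dmu; apply/ler_addgt0Pr => e /Tapprox[z [Tz /ltW]].
  exact: le_trans (DT _ _ Dmu Tz).
- by move=> e e0; exists v; split=> //; rewrite gtrBl.
- by move=> z; exact: DT.
Qed.

End RealInfima.

Section ConvexFunctions.
Context (R : realType) (n : nat).
Implicit Types (phi psi : ('I_n -> R) -> R) (x y : 'I_n -> R).

Definition convex_set (X : ('I_n -> R) -> Prop) : Prop :=
  forall x y t, 0 <= t -> t <= 1 -> X x -> X y ->
    X (fun k => t * x k + (1 - t) * y k).

Lemma convex_sublevels (I : Type) (phi : I -> ('I_n -> R) -> R) :
  (forall i, convex_fun (phi i)) -> convex_set (fun x => forall i, phi i x <= 0).
Proof.
move=> cphi x y t t0 t1 hx hy i; apply: le_trans (cphi i x y t t0 t1) _.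
by have := hx i; have := hy i; nra.
Qed.

Lemma convex_fun_cst (c : R) : convex_fun (fun _ : 'I_n -> R => c).
Proof. by move=> x y t _ _; lra. Qed.

Lemma convex_funD phi psi :
  convex_fun phi -> convex_fun psi -> convex_fun (fun x => phi x + psi x).
Proof.
move=> cphi cpsi x y t t0 t1.
by apply: le_trans (lerD (cphi x y t t0 t1) (cpsi x y t t0 t1)) _; lra.
Qed.

Lemma convex_funZ phi (c : R) : 0 <= c ->
  convex_fun phi -> convex_fun (fun x => c * phi x).
Proof.
move=> c0 cphi x y t t0 t1.
by apply: le_trans (ler_wpM2l c0 (cphi x y t t0 t1)) _; lra.
Qed.

Lemma convex_fun_shift phi (a : 'I_n -> R) :
  convex_fun phi -> convex_fun (fun x => phi (fun i => x i + a i)).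
Proof.
move=> cphi x y t t0 t1 /=; apply: le_trans (cphi _ _ t t0 t1).
have <- : (fun i => t * x i + (1 - t) * y i + a i) =
          (fun i => t * (x i + a i) + (1 - t) * (y i + a i)).
  by apply/funext => i; ring.
exact: lexx.
Qed.

End ConvexFunctions.

Section SingleMultiplier.
Context (R : realType) (n : nat).
Variables (X : ('I_n -> R) -> Prop) (f g : ('I_n -> R) -> R) (v : R).
Hypotheses (convX : convex_set X) (convf : convex_fun f) (convg : convex_fun g).
Hypothesis f_ge : forall x, X x -> g x <= 0 -> v <= f x.

(* Compare [f] with [v] where the segment from [x] to [y] meets the zero level
   of the affine interpolation of [g]. *)
Lemma multiplier_slopes_le x y : X x -> X y -> 0 < g x -> g y < 0 ->
  (v - f x) / g x <= (f y - v) / - g y.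
Proof.
move=> Xx Xy gx gy; have gxy : 0 < g x - g y by lra.
pose t := g x / (g x - g y).
have t0 : 0 <= t by rewrite divr_ge0 ?ltW.
have t1 : t <= 1 by rewrite ler_pdivrMr // mul1r; lra.
have tE : t * (g x - g y) = g x by rewrite divfK ?gt_eqF.
have vz : v <= t * f y + (1 - t) * f x.
  apply: le_trans (convf y x t0 t1); apply: f_ge; first exact: convX.
  by apply: le_trans (convg y x t0 t1) _; lra.
rewrite ler_pdivrMr // mulrAC ler_pdivlMr ?oppr_gt0 //.
by have := ler_wpM2r (ltW gxy) vz; have := congr1 ( *%R (f y - f x)) tE; lra.
Qed.

Lemma lagrange_multiplier : (exists y, X y /\ g y < 0) ->
  exists lam, 0 <= lam /\ forall x, X x -> v <= f x + lam * g x.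
Proof.
move=> [y0 [Xy0 gy0]].
pose lower a := a = 0 \/ exists x, [/\ X x, 0 < g x & a = (v - f x) / g x].
pose upper b := exists y, [/\ X y, g y < 0 & b = (f y - v) / - g y].
have [|||lam [lam_ge lam_le]] := @separating_point R lower upper.
- by exists 0; left.
- by exists ((f y0 - v) / - g y0), y0.
- move=> a b [->|[x [Xx gx ->]]] [y [Xy gy ->]]; last exact: multiplier_slopes_le.
  by rewrite divr_ge0 ?oppr_ge0 ?subr_ge0 ?f_ge ?ltW.
exists lam; split=> [|x Xx]; first by apply: lam_ge; left.
have [gx|gx|gx] := ltgtP (g x) 0.
- have : lam <= (f x - v) / - g x by apply: lam_le; exists x.
  by rewrite ler_pdivlMr ?oppr_gt0 //; lra.
- have : (v - f x) / g x <= lam by apply: lam_ge; right; exists x.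
  by rewrite ler_pdivrMr //; lra.
- by rewrite gx mulr0 addr0 f_ge ?gx.
Qed.

End SingleMultiplier.

Lemma lagrange_multipliers (R : realType) n m (g : 'I_m -> ('I_n -> R) -> R) f (v : R) :
  convex_fun f -> (forall i, convex_fun (g i)) ->
  (exists x, forall i, g i x < 0) ->
  (forall x, (forall i, g i x <= 0) -> v <= f x) ->
  exists lam : 'I_m -> R, (forall i, 0 <= lam i) /\
    forall x, v <= f x + \sum_i lam i * g i x.
Proof.
elim: m g f => [|m IHm] g f convf convg [y gy] f_ge.
  by exists (fun _ => 0); split=> // x; rewrite big_ord0 addr0 f_ge // => -[].
pose X x := forall i, g (lift ord0 i) x <= 0.
have convX : convex_set X by exact: convex_sublevels.
have [||lam0 [lam0_ge0 lam0P]] :=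
    lagrange_multiplier (v := v) convX convf (convg ord0).
- move=> x Xx gx; apply: f_ge => i.
  by case: (unliftP ord0 i) => [j ->|->]; [exact: Xx | exact: gx].
- by exists y; split=> [i|]; [exact: ltW | exact: gy].
have [||||lam [lam_ge0 lamP]] :=
    IHm (fun i => g (lift ord0 i)) (fun x => f x + lam0 * g ord0 x).
- by apply: convex_funD => //; exact: convex_funZ.
- by move=> i.
- by exists y.
- exact: lam0P.
exists (fun i => oapp lam lam0 (unlift ord0 i)); split.
  by move=> i; case: unliftP => /=.
move=> x; rewrite big_ord_recl unlift_none /= addrA.
by under eq_bigr do rewrite liftK; exact: lamP.
Qed.

Section UnivariateGrowth.
Context (R : rcfType).
Implicit Types (p h : {poly R}).

Lemma bounded_below_lead_coef_gt0 p (A : R) :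
  (forall t, 0 <= t -> A <= p.[t]) -> (1 < size p)%N -> 0 < lead_coef p.
Proof.
move=> pA sp; rewrite ltNge; apply/negP; rewrite le_eqVlt => /orP[|lead_lt0].
  by rewrite lead_coef_eq0 => /eqP p0; rewrite p0 size_poly0 in sp.
have [||z zP] := @poly_lim_infty R (- p) (1 - A).
- by rewrite lead_coefN oppr_gt0.
- by rewrite size_polyN.
have := pA (Num.max 0 z); have := zP (Num.max 0 z).
by rewrite !le_max !lexx orbT hornerN => /(_ isT) ? /(_ isT) ?; lra.
Qed.

Lemma bounded_poly_size_le1 p (A B : R) :
  (forall t, 0 <= t -> A <= p.[t] <= B) -> (size p <= 1)%N.
Proof.
move=> pAB; rewrite leqNgt; apply/negP => sp.
have := @bounded_below_lead_coef_gt0 p A.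
have := @bounded_below_lead_coef_gt0 (- p) (- B).
rewrite size_polyN lead_coefN => /(_ _ sp) + /(_ _ sp).
have pA t : 0 <= t -> A <= p.[t] by case/pAB/andP.
have pB t : 0 <= t -> - B <= (- p).[t].
  by rewrite hornerN lerN2; case/pAB/andP.
by move=> /(_ pB) ? /(_ pA) ?; lra.
Qed.

Lemma horner_ge0_right h (a b : R) :
  a < b -> (forall t, a < t < b -> 0 <= h.[t]) -> 0 <= h.[a].
Proof.
move=> ab h_ge0; rewrite leNgt; apply/negP => ha.
have [|d d_gt0 h_near] := @poly_cont R a h (- h.[a]); first by rewrite oppr_gt0.
pose e := Num.min d (b - a) / 2.
have [e_gt0 ed eb] : [/\ 0 < e, e < d & e < b - a].
  by rewrite /e; case: (leP d (b - a)) => ?; split; lra.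
have : 0 <= h.[a + e] by apply: h_ge0; lra.
have := h_near (a + e); rewrite [a + e]addrC addrK gtr0_norm // => /(_ ed).
by rewrite ltr_norml => /andP[_]; lra.
Qed.

Lemma horner_ge0_left h (a b : R) :
  b < a -> (forall t, b < t < a -> 0 <= h.[t]) -> 0 <= h.[a].
Proof.
move=> ba h_ge0; have hN t : h.[t] = (h \Po - 'X).[- t].
  by rewrite horner_comp !hornerE opprK.
rewrite hN; apply: (@horner_ge0_right _ (- a) (- b)); first by rewrite ltrN2.
by move=> t /andP[? ?]; rewrite -[t]opprK -hN; apply: h_ge0; lra.
Qed.

Lemma nonneg_double_root p (c : R) :
  (forall t, 0 <= p.[t]) -> root p c ->
  exists2 k : {poly R}, p = k * ('X - c%:P) ^+ 2 & forall t, 0 <= k.[t].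
Proof.
move=> p_ge0 /factor_theorem[h hE].
have h_ge0 t : 0 <= h.[t] * (t - c) by have := p_ge0 t; rewrite hE !hornerE.
have hc_ge0 : 0 <= h.[c].
  apply: (@horner_ge0_right _ _ (c + 1)); first lra.
  by move=> t /andP[? _]; have := h_ge0 t; rewrite pmulr_lge0 //; lra.
have hc_le0 : 0 <= (- h).[c].
  apply: (@horner_ge0_left _ _ (c - 1)); first lra.
  move=> t /andP[_ ?]; have := h_ge0 t.
  by rewrite hornerN -mulrNN pmulr_lge0 //; lra.
have /factor_theorem[k kE] : root h c.
  by rewrite /root eq_le hc_ge0 andbT -oppr_ge0 -hornerN.
exists k; first by rewrite hE kE expr2 mulrA.
have k_ge0 t : t != c -> 0 <= k.[t].
  move=> tc; have := p_ge0 t; rewrite hE kE !hornerE -mulrA -expr2 pmulr_lge0 //.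
  by rewrite lt_def sqr_ge0 sqrf_eq0 subr_eq0 tc.
move=> t; have [->|] := eqVneq t c; last exact: k_ge0.
apply: (@horner_ge0_right _ _ (c + 1)); first lra.
by move=> s /andP[cs _]; apply: k_ge0; rewrite gt_eqF.
Qed.

Lemma horner_ge0_deriv p t : 0 <= p.[0] ->
  (forall s, 0 <= s -> 0 <= p^`().[s]) -> 0 <= t -> 0 <= p.[t].
Proof.
move=> p0 dp t0; apply: le_trans p0 (@ler_hornerW R 0 t p _ _ _ _ _ t0).
- by move=> s; rewrite in_itv /= => /andP[/ltW s0 _]; exact: dp.
- by rewrite in_itv /= lexx.
- by rewrite in_itv /= lexx t0.
Qed.

End UnivariateGrowth.

Section OrdinalConcatenation.
Context (T : Type) (k l : nat) (p : 'I_k -> T) (q : 'I_l -> T).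

Definition ord_cat (i : 'I_(k + l)) : T :=
  match split i with inl j => p j | inr j => q j end.

Lemma ord_cat_forall (P : T -> Prop) :
  (forall i, P (p i)) -> (forall i, P (q i)) -> forall i, P (ord_cat i).
Proof. by move=> Pp Pq i; rewrite /ord_cat; case: split. Qed.

Lemma sum_ord_cat (V : nmodType) (F : T -> V) :
  \sum_i F (ord_cat i) = \sum_i F (p i) + \sum_i F (q i).
Proof.
rewrite big_split_ord /ord_cat; congr (_ + _); apply: eq_bigr => i _.
  by rewrite (unsplitK (inl i)).
by rewrite (unsplitK (inr i)).
Qed.

End OrdinalConcatenation.

Section UnivariateSOS.
Context (R : realType).
Implicit Types (q s : {poly R}).

Lemma bounded_below_poly_min q (A : R) :
  (forall t, A <= q.[t]) -> exists c, forall t, q.[c] <= q.[t].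
Proof.
move=> q_ge; have [sq|sq] := leqP (size q) 1%N.
  by exists 0 => t; rewrite (size1_polyC sq) !hornerC.
have sN : size (q \Po - 'X) = size q.
  by rewrite size_comp_poly2 // size_polyN size_polyX.
have [||z1 z1P] := @poly_lim_infty R q q.[0] => //.
  by apply: (@bounded_below_lead_coef_gt0 _ _ A).
have [||z2 z2P] := @poly_lim_infty R (q \Po - 'X) q.[0]; rewrite ?sN //.
  by apply: (@bounded_below_lead_coef_gt0 _ _ A) => [t _|]; rewrite ?horner_comp ?sN.
pose B := Num.max 0 (Num.max z1 z2).
have [B_ge0 z1B z2B] : [/\ 0 <= B, z1 <= B & z2 <= B].
  by rewrite /B !le_max !lexx !orbT.
have [||c cB cmin] := @EVT_min R (horner q) (- B) B; first lra.
  by apply: continuous_subspaceT => x; exact: continuous_horner.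
have c0 : q.[c] <= q.[0] by apply: cmin; rewrite in_itv /=; lra.
exists c => t; have [tB|tB] := leP `|t| B.
  by apply: cmin; rewrite in_itv /= -ler_norml.
apply: le_trans c0 _; move: tB; rewrite lter_normr => /orP[tB|tB].
  by apply: z1P; lra.
by have := z2P (- t); rewrite horner_comp !hornerE opprK; apply; lra.
Qed.

Lemma sos_upolyC d (c : R) : 0 <= c -> sos_upoly d c%:P.
Proof.
move=> c0; exists 1%N, (fun _ => (Num.sqrt c)%:P); split=> [i|].
  by rewrite (leq_trans (size_polyC_leq1 _)).
by rewrite big_ord1 -polyC_exp sqr_sqrtr.
Qed.

Lemma sos_upolyD d s1 s2 : sos_upoly d s1 -> sos_upoly d s2 -> sos_upoly d (s1 + s2).
Proof.
move=> [k [p [sp ->]]] [l [q [sq ->]]]; exists (k + l)%N, (ord_cat p q).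
split; last by rewrite (sum_ord_cat p q (fun h => h ^+ 2)).
exact: (@ord_cat_forall _ _ _ p q (fun h => size h <= d.+1)%N).
Qed.

Lemma sos_upolyM_sqr d e s q :
  sos_upoly d s -> (size q <= e.+1)%N -> sos_upoly (d + e) (s * q ^+ 2).
Proof.
move=> [k [qs [sqs ->]]] sq; exists k, (fun i => qs i * q); split=> [i|].
  by have := size_polyMleq (qs i) q; have := sqs i; lia.
by rewrite mulr_suml; apply: eq_bigr => i _; rewrite exprMn.
Qed.

Lemma sos_upoly_shift d s (a : R) : sos_upoly d s -> sos_upoly d (s \Po ('X + a%:P)).
Proof.
move=> [k [q [sq ->]]]; exists k, (fun i => q i \Po ('X + a%:P)); split=> [i|].
  by rewrite size_comp_poly2 ?size_XaddC.
by rewrite rmorph_sum; apply: eq_bigr => i _; rewrite rmorphXn.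
Qed.

Lemma nonneg_poly_sub_min_factor q : (forall t, 0 <= q.[t]) ->
  exists (c : R) (k : {poly R}), [/\ q = k * ('X - c%:P) ^+ 2 + q.[c]%:P,
    forall t, 0 <= k.[t] & (size k <= (size q).-2)%N].
Proof.
move=> /bounded_below_poly_min[c cmin].
have [||k kE k_ge0] := @nonneg_double_root R (q - q.[c]%:P) c.
- by move=> t; rewrite !hornerE subr_ge0.
- by rewrite /root !hornerE subrr.
exists c, k; split=> //; first by rewrite -kE subrK.
have [->|k_neq0] := eqVneq k 0; first by rewrite size_poly0.
have sk : size (q - q.[c]%:P) = (size k).+2.
  rewrite kE size_proper_mul ?size_exp_XsubC ?addn3 //.
  by rewrite lead_coef_exp lead_coefXsubC expr1n mulr1 lead_coef_eq0.
have := size_polyD q (- q.[c]%:P); rewrite sk size_polyN leq_max size_polyC.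
by case/orP; [case: (size q) => [|[]] | case: eqP].
Qed.

(* The bound allows degree [2 * d + 1], which a nonnegative polynomial cannot
   have. *)
Lemma nonneg_poly_sos d q :
  (forall t, 0 <= q.[t]) -> (size q <= (2 * d).+2)%N -> sos_upoly d q.
Proof.
elim: d q => [|d IHd] q q_ge0 sq;
  have [c [k [qE k_ge0 sk]]] := nonneg_poly_sub_min_factor q_ge0.
  have /eqP k0 : k == 0 by rewrite -size_poly_eq0; lia.
  by rewrite qE k0 mul0r add0r; exact: sos_upolyC.
rewrite qE; apply: sos_upolyD; last exact: sos_upolyC.
by rewrite -addn1; apply: sos_upolyM_sqr; rewrite ?size_XsubC //; apply: IHd => //; lia.
Qed.

End UnivariateSOS.

Section QuadraticForms.
Context (T : comNzRingType).

Definition quad_form k (A : 'M[T]_k) (x : 'cV[T]_k) : T := (x^T *m A *m x) 0 0.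

Lemma quad_formE k (A : 'M[T]_k) x :
  quad_form A x = \sum_i \sum_j x i 0 * x j 0 * A i j.
Proof.
rewrite /quad_form mxE exchange_big; apply: eq_bigr => j _.
by rewrite mxE mulr_suml; apply: eq_bigr => i _; rewrite mxE mulrAC.
Qed.

Lemma quad_form_gram k l (B : 'M[T]_(l, k)) x :
  quad_form (B^T *m B) x = \sum_i (B *m x) i 0 ^+ 2.
Proof.
rewrite /quad_form mulmxA -mulmxA -trmx_mul mxE.
by apply: eq_bigr => i _; rewrite mxE.
Qed.

Lemma quad_form_block k (a : T) (b : 'rV[T]_k) (C : 'M[T]_k) t v :
  quad_form (block_mx a%:M b b^T C) (col_mx t%:M v)
  = t ^+ 2 * a + 2 * t * (b *m v) 0 0 + quad_form C v.
Proof.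
rewrite /quad_form tr_col_mx mul_row_block mul_row_col !mulmxDl tr_scalar_mx.
rewrite -scalar_mxM -trmx_mul !mul_scalar_mx mul_mx_scalar -scalemxAl.
by rewrite !mxE mulr1n; ring.
Qed.

End QuadraticForms.

Section GramFactorization.
Context (R : realType).

Lemma affine_bounded_below_slope0 (s c : R) : (forall t, 0 <= t * s + c) -> s = 0.
Proof.
move=> h; apply/eqP/negP => /negP s0.
by have := h (- (c + 1) / s); rewrite divfK //; lra.
Qed.

Lemma psd_block_pivot_ge0 k (a : R) (b : 'rV[R]_k) (C : 'M[R]_k) :
  psd (block_mx a%:M b b^T C) -> 0 <= a.
Proof.
move=> [_ /(_ (col_mx 1%:M 0))]; rewrite -/(quad_form _ _) quad_form_block.
by rewrite /quad_form !mulmx0 !mxE expr1n mul1r mulr0 !addr0.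
Qed.

Lemma psd_block_pivot0_row0 k (b : 'rV[R]_k) (C : 'M[R]_k) :
  psd (block_mx 0%:M b b^T C) -> b = 0.
Proof.
move=> [_ form_ge0]; have : (b *m b^T) 0 0 = 0.
  apply: (@affine_bounded_below_slope0 _ (quad_form C b^T)) => t.
  have := form_ge0 (col_mx (t / 2)%:M b^T); rewrite -/(quad_form _ _) quad_form_block.
  by rewrite mulr0 add0r [2 * _]mulrC divfK // pnatr_eq0.
rewrite mxE => /eqP; rewrite psumr_eq0 => [/allP b0|j _]; last first.
  by rewrite mxE -expr2 sqr_ge0.
apply/rowP => j; have := b0 j (mem_index_enum _).
by rewrite /= !mxE mulf_eq0 orbb => /eqP.
Qed.

(* If [a = 0] then [a^-1 = 0] and the statement is about [C] itself. *)
Lemma psd_schur k (a : R) (b : 'rV[R]_k) (C : 'M[R]_k) :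
  psd (block_mx a%:M b b^T C) -> psd (C - a^-1 *: (b^T *m b)).
Proof.
move=> [symA form_ge0]; split.
  move: symA; rewrite tr_block_mx => /eq_block_mx[_ _ _ symC].
  by rewrite raddfB /= linearZ /= trmx_mul trmxK symC.
move=> v; pose s := (b *m v) 0 0.
have := form_ge0 (col_mx (- (s / a))%:M v); rewrite -!/(quad_form _ _) quad_form_block.
have -> : quad_form (C - a^-1 *: (b^T *m b)) v = quad_form C v - a^-1 * s ^+ 2.
  have := quad_form_gram b v; rewrite big_ord1 -/s => <-.
  rewrite /quad_form mulmxBr mulmxBl -scalemxAr -scalemxAl.
  by rewrite !mxE.
rewrite -/s; have [->|a_neq0] := eqVneq a 0; first by rewrite invr0 !mulr0; lra.
by congr (_ <= _); field.
Qed.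

Lemma psd_gram k (A : 'M[R]_k) : psd A -> exists B : 'M[R]_k, A = B^T *m B.
Proof.
elim: k A => [|k IHk] A psdA; first by exists 0; apply/matrixP => -[].
pose a := A 0 0; pose b : 'rV_k := ursubmx (A : 'M_(1 + k)).
pose C : 'M_k := drsubmx (A : 'M_(1 + k)).
have AE : A = block_mx a%:M b b^T C.
  rewrite -[LHS](@submxK _ 1 k 1 k) /b trmx_ursub psdA.1 [ulsubmx _]mx11_scalar.
  by rewrite !mxE !lshift0.
rewrite AE in psdA; have [B BE] := IHk _ (psd_schur psdA).
have a_ge0 := psd_block_pivot_ge0 psdA; pose ra := Num.sqrt a.
pose c := ra^-1 *: b; have ra_c : ra *: c = b.
  have [ra0|ra_neq0] := eqVneq ra 0; last by rewrite scalerA divff ?scale1r.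
  have a0 : a = 0 by apply/eqP; rewrite eq_le a_ge0 andbT -sqrtr_eq0 -/ra ra0.
  by move: psdA; rewrite a0 /c => /psd_block_pivot0_row0 ->; rewrite !scaler0.
have cTc : c^T *m c = a^-1 *: (b^T *m b).
  rewrite /c [_^T]linearZ /= -scalemxAl -scalemxAr scalerA -invfM -expr2.
  by rewrite sqr_sqrtr.
exists (block_mx ra%:M c 0 B).
rewrite AE (@tr_block_mx _ 1 k 1 k) (@mulmx_block _ 1 k 1 k 1 k) tr_scalar_mx trmx0.
rewrite !mul0mx !mulmx0 !addr0 -scalar_mxM -expr2 sqr_sqrtr //.
by rewrite mul_scalar_mx ra_c mul_mx_scalar -linearZ /= ra_c cTc -BE addrC subrK.
Qed.

End GramFactorization.

Section RadialMoments.
Context (R : realType).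

(* The entries are the integrals of [(1 - s) * s ^+ (i + j)] over [0, 1]. *)
Definition radial_mx k : 'M[R]_k :=
  \matrix_(i < k, j < k) ((i + j).+1 * (i + j).+2)%:R^-1.

Lemma psd_radial_mx k : psd (radial_mx k).
Proof.
split=> [|v]; first by apply/matrixP => i j; rewrite !mxE addnC.
rewrite -/(quad_form _ _).
pose w : {poly R} := \sum_i v i 0 *: 'X^i.
pose W := \sum_i \sum_j (v i 0 * v j 0 * radial_mx k i j) *: 'X^((i + j).+2).
have W2 : W^`()^`() = w ^+ 2.
  rewrite expr2 /w mulr_suml /W !raddf_sum /=; apply: eq_bigr => i _.
  rewrite mulr_sumr !raddf_sum /=; apply: eq_bigr => j _.
  rewrite !derivZ derivXn derivMn derivXn /= -mulrnA mxE -scalerMnr scalerMnl.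
  rewrite -mulr_natr divfK ?pnatr_eq0 ?muln_eq0 //.
  by rewrite -scalerAl -scalerAr -exprD scalerA.
have -> : quad_form (radial_mx k) v = W.[1].
  rewrite quad_formE /W horner_sum; apply: eq_bigr => i _.
  rewrite horner_sum; apply: eq_bigr => j _.
  by rewrite hornerZ hornerXn expr1n mulr1.
have W0 : W.[0] = 0.
  rewrite horner_sum big1 // => i _; rewrite horner_sum big1 // => j _.
  by rewrite hornerZ hornerXn expr0n mulr0.
have dW0 : W^`().[0] = 0.
  rewrite raddf_sum horner_sum big1 // => i _.
  rewrite raddf_sum horner_sum big1 // => j _.
  by rewrite /= derivZ derivXn hornerZ hornerMn hornerXn expr0n mul0rn mulr0.
apply: horner_ge0_deriv; rewrite ?W0 ?ler01 // => s.
apply: horner_ge0_deriv; rewrite ?dW0 // => x _.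
by rewrite W2 horner_exp sqr_ge0.
Qed.

End RadialMoments.

Section MPolyEvaluation.
Context (R : comNzRingType) (n : nat).
Implicit Types (p q : {mpoly R[n]}) (x d : 'I_n -> R).

Lemma mpoly_alg_ind (P : {mpoly R[n]} -> Prop) :
  (forall c, P c%:MP) -> (forall i, P 'X_i) ->
  (forall p q, P p -> P q -> P (p + q)) ->
  (forall p q, P p -> P q -> P (p * q)) -> forall p, P p.
Proof.
move=> PC PX PD PM p; rewrite [p]mpolyE.
apply: (big_ind P); [by rewrite -mpolyC0 | exact: PD | move=> m _].
rewrite -mul_mpolyC; apply: (PM) => //; rewrite mpolyXE_id.
apply: (big_ind P); [by rewrite -mpolyC1 | exact: PM | move=> i _].
elim: (m i) => [|k IHk]; first by rewrite expr0 -mpolyC1.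
by rewrite exprS; apply: PM.
Qed.

Lemma meval_at0 p : p.@[fun _ => 0] = p@_0%MM.
Proof.
elim/mpoly_alg_ind: p => [c|i|p q hp hq|p q hp hq].
- by rewrite mevalC mcoeffC eqxx mulr1.
- by rewrite mevalXU mcoeffX mnm1_eq0.
- by rewrite mevalD mcoeffD hp hq.
- by rewrite mevalM rmorphM /= hp hq.
Qed.

Lemma meval_line p x d :
  exists h : {poly R}, forall t, h.[t] = p.@[fun i => x i + t * d i].
Proof.
elim/mpoly_alg_ind: p => [c|i|p q [h hE] [k kE]|p q [h hE] [k kE]].
- by exists c%:P => t; rewrite hornerC mevalC.
- by exists ((x i)%:P + d i *: 'X) => t; rewrite mevalXU !hornerE mulrC.
- by exists (h + k) => t; rewrite hornerD hE kE mevalD.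
- by exists (h * k) => t; rewrite hornerM hE kE mevalM.
Qed.

Lemma meval_ray p d : p@_0%MM = 0 ->
  exists h : {poly R}, forall t, p.@[fun i => t * d i] = t * h.[t].
Proof.
move=> p0; have [k kE] := meval_line p (fun _ => 0) d.
have kE' t : k.[t] = p.@[fun i => t * d i].
  by rewrite kE; apply: meval_eq => i; rewrite add0r.
have /factor_theorem[h hE] : root k 0.
  rewrite /root kE' -[X in _ == X]p0 -meval_at0.
  by apply/eqP/meval_eq => i; rewrite mul0r.
by exists h => t; rewrite -kE' hE hornerM hornerXsubC subr0 mulrC.
Qed.

End MPolyEvaluation.

Section MPolyTranslation.
Context (R : comNzRingType) (n : nat).
Implicit Types (p q : {mpoly R[n]}) (a x : 'I_n -> R).

Definition mtranslate a p : {mpoly R[n]} :=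
  p \mPo [tuple 'X_i + (a i)%:MP | i < n].

HB.instance Definition _ a :=
  GRing.LRMorphism.copy (mtranslate a) (comp_mpoly [tuple 'X_i + (a i)%:MP | i < n]).

Lemma mtranslateC a c : mtranslate a c%:MP = c%:MP.
Proof. exact: comp_mpolyC. Qed.

Lemma mtranslateXU a i : mtranslate a 'X_i = 'X_i + (a i)%:MP.
Proof. by rewrite /mtranslate comp_mpolyXU -tnth_nth tnth_mktuple. Qed.

Lemma meval_mtranslate a p x : (mtranslate a p).@[x] = p.@[fun i => x i + a i].
Proof.
rewrite /mtranslate comp_mpoly_meval; apply: meval_eq => i.
by rewrite tnth_mktuple mevalD mevalXU mevalC.
Qed.

Lemma mcoeff0_mtranslate a p : (mtranslate a p)@_0%MM = p.@[a].
Proof. by rewrite -meval_at0 meval_mtranslate; apply: meval_eq => i; rewrite add0r. Qed.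

Lemma mtranslateNK a p : mtranslate (fun i => - a i) (mtranslate a p) = p.
Proof.
elim/mpoly_alg_ind: p => [c|i|p q hp hq|p q hp hq].
- by rewrite !mtranslateC.
- by rewrite mtranslateXU rmorphD /= mtranslateXU mtranslateC mpolyCN subrK.
- by rewrite !rmorphD /= hp hq.
- by rewrite !rmorphM /= hp hq.
Qed.

Lemma mderivXU i j : mderiv i 'X_j = (j == i)%:R :> {mpoly R[n]}.
Proof.
rewrite mderivX mnm1E; case: eqP => [->|_]; last by rewrite scale0r.
have -> : (U_(i) - U_(i) = 0)%MM by apply/mnmP => k; rewrite mnmBE subnn mnm0E.
by rewrite scale1r mpolyX0.
Qed.

Lemma mderiv_mtranslate a i p : mderiv i (mtranslate a p) = mtranslate a (mderiv i p).
Proof.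
elim/mpoly_alg_ind: p => [c|j|p q hp hq|p q hp hq].
- by rewrite mtranslateC mderivC rmorph0.
- by rewrite mtranslateXU mderivD mderivC addr0 mderivXU rmorph_nat.
- by rewrite rmorphD !mderivD rmorphD /= hp hq.
- by rewrite rmorphM !mderivM rmorphD !rmorphM /= hp hq.
Qed.

End MPolyTranslation.

Section EulerOperator.
Context (R : comNzRingType) (n : nat).
Implicit Types (p : {mpoly R[n]}).

Definition euler p : {mpoly R[n]} := \sum_i 'X_i * mderiv i p.

Lemma mulX_mderivX i m : 'X_i * mderiv i 'X_[m] = (m i)%:R *: 'X_[m] :> {mpoly R[n]}.
Proof.
rewrite mderivX -scalerAr -mpolyXD; case: (posnP (m i)) => [->|mi_gt0].
  by rewrite !scale0r.
by rewrite addmC submK // lep1mP -lt0n.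
Qed.

Lemma mcoeff_euler p m : (euler p)@_m = (mdeg m)%:R * p@_m.
Proof.
rewrite raddf_sum /= mdegE natr_sum mulr_suml; apply: eq_bigr => i _.
rewrite [in LHS](mpolyE p) [in RHS](mpolyE p) !raddf_sum !mulr_sumr raddf_sum /=.
apply: eq_bigr => k _; rewrite mderivZ -scalerAr mulX_mderivX !mcoeffZ mcoeffX.
by case: eqP => [->|_]; rewrite ?mulr0 // mulrCA.
Qed.

End EulerOperator.

Section DegreeBounds.
Context (R : realType) (n : nat).
Implicit Types (p q : {mpoly R[n]}).

Lemma mdeg_leP p k : mdeg_le p k <-> (forall m, (k < mdeg m)%N -> p@_m = 0).
Proof.
split=> [pk m km|pk]; first by apply/memN_msupp_eq0/msize_mdeg_ge/(leq_trans pk).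
rewrite /mdeg_le msizeE; apply/bigmax_leqP_seq => m mp _.
by rewrite ltnS leqNgt; apply: contraL mp => /pk/eqP; rewrite mcoeff_eq0.
Qed.

Lemma mdeg_leW p j k : (j <= k)%N -> mdeg_le p j -> mdeg_le p k.
Proof. by move=> jk /leq_trans; apply. Qed.

Lemma mdeg_leC (c : R) k : mdeg_le (c%:MP : {mpoly R[n]}) k.
Proof. by rewrite /mdeg_le msizeC; case: eqP. Qed.

Lemma mdeg_leX (m : 'X_{1..n}) k : (mdeg m <= k)%N -> mdeg_le ('X_[m] : {mpoly R[n]}) k.
Proof. by rewrite /mdeg_le msizeX ltnS. Qed.

Lemma mdeg_leD p q k : mdeg_le p k -> mdeg_le q k -> mdeg_le (p + q) k.
Proof. by move=> pk qk; rewrite /mdeg_le (leq_trans (msizeD_le _ _)) // geq_max pk. Qed.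

Lemma mdeg_leZ (c : R) p k : mdeg_le p k -> mdeg_le (c *: p) k.
Proof. exact: leq_trans (msizeZ_le _ _). Qed.

Lemma mdeg_leM p q j k : mdeg_le p j -> mdeg_le q k -> mdeg_le (p * q) (j + k).
Proof.
rewrite /mdeg_le => pj qk; have [->|p0] := eqVneq p 0; first by rewrite mul0r msize0.
have [->|q0] := eqVneq q 0; first by rewrite mulr0 msize0.
by rewrite msizeM //; have := leq_add pj qk; rewrite addSn addnS; case: (_ + _)%N.
Qed.

Lemma mdeg_leXn p j k : mdeg_le p j -> mdeg_le (p ^+ k) (k * j).
Proof.
move=> pj; elim: k => [|k IHk]; first by rewrite expr0 -mpolyC1; exact: mdeg_leC.
by rewrite exprS mulSn; exact: mdeg_leM.
Qed.

Lemma mdeg_le_sum (I : Type) (s : seq I) (P : pred I) (F : I -> {mpoly R[n]}) k :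
  (forall i, P i -> mdeg_le (F i) k) -> mdeg_le (\sum_(i <- s | P i) F i) k.
Proof.
move=> Fk; apply: (big_ind (fun p => mdeg_le p k)) => // [|p q].
  by rewrite -mpolyC0; exact: mdeg_leC.
exact: mdeg_leD.
Qed.

Lemma mdeg_le_mtranslate a p k : mdeg_le p k -> mdeg_le (mtranslate a p) k.
Proof.
move=> pk; rewrite [p]mpolyE raddf_sum big_seq.
apply: mdeg_le_sum => m /msize_mdeg_lt mp; rewrite /= linearZ /=; apply: mdeg_leZ.
apply: (@mdeg_leW _ (mdeg m)); first by rewrite -ltnS (leq_trans mp).
rewrite /mtranslate comp_mpolyX mdegE.
apply: (big_ind2 (@mdeg_le R n)) => [|p1 k1 p2 k2|i _].
- by rewrite -mpolyC1; exact: mdeg_leC.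
- exact: mdeg_leM.
rewrite tnth_mktuple -[X in mdeg_le _ X]muln1; apply: mdeg_leXn; apply: mdeg_leD.
  by apply: mdeg_leX; rewrite mdeg1.
exact: mdeg_leC.
Qed.

(* The squares of the leading coefficients cannot cancel. *)
Lemma mdeg_le_sum_sqr k (q : 'I_k -> {mpoly R[n]}) r :
  mdeg_le (\sum_i q i ^+ 2) (2 * r) -> forall i, mdeg_le (q i) r.
Proof.
move=> sum_le i0; rewrite /mdeg_le leqNgt; apply/negP => ri0.
pose i1 := [arg max_(i > i0) mlead (q i)]%O; pose m := mlead (q i1).
have i1_max i : (mlead (q i) <= m)%O.
  by rewrite /m /i1; case: Order.TotalTheory.arg_maxP => // j _ /(_ i isT).
have rm : (r < mdeg m)%N.
  apply: leq_trans (lemc_mdeg (i1_max i0)); rewrite -ltnS mlead_deg //.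
  by apply: contraTneq ri0 => ->; rewrite msize0.
have : (\sum_i q i ^+ 2)@_(m + m) = 0.
  by move/mdeg_leP: sum_le; apply; rewrite mdegD addnn -mul2n ltn_mul2l.
rewrite raddf_sum /=; under eq_bigr => i _ do rewrite expr2 mleadcMW //.
move/eqP; rewrite psumr_eq0 => [|i _]; last by rewrite -expr2 sqr_ge0.
move/allP/(_ i1 (mem_index_enum _)); rewrite /= mulf_eq0 orbb mleadc_eq0 => /eqP q0.
by move: rm; rewrite /m q0 mlead0 mdeg0.
Qed.

End DegreeBounds.

Section ConvexPolynomialMinimum.
Context (R : realType).
Local Open Scope classical_set_scope.

Lemma compact_unit_sphere n : compact [set d : 'rV[R]_n | `|d| = 1].
Proof.
apply: bounded_closed_compact; first by exists 1; split=> // M M1 d /= ->; exact: ltW.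
apply: (@preimage_closed _ _ (fun d : 'rV[R]_n => `|d|) [set 1]).
  by move=> d _; exact: norm_continuous.
exact: closed_eq.
Qed.

(* Otherwise every ray leaves [C] near its direction, hence uniformly over the
   compact unit sphere. *)
Lemma recession_direction n (C : set 'rV[R]_n) :
  closed C -> (forall x t, C x -> 0 <= t <= 1 -> C (t *: x)) -> ~ bounded_set C ->
  exists2 d, d != 0 & forall t, 0 <= t -> C (t *: d).
Proof.
move=> closedC starC; apply: contra_notP => noray.
pose S := [set d : 'rV[R]_n | `|d| = 1].
have escape : \forall t \near +oo, S `<=` [set d | ~ C (t *: d)].
  move/compact_near_coveringP: (@compact_unit_sphere n); apply=> d Sd.
  have [t0 t0_ge0 nC] : exists2 t0, 0 <= t0 & ~ C (t0 *: d).
    apply: contrapT => C_ray; apply: noray; exists d.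
      by apply: contra_eq_neq Sd => ->; rewrite normr0 eq_sym oner_neq0.
    by move=> t t_ge0; apply: contrapT => nC; apply: C_ray; exists t.
  have t0_escape : \forall d' \near d, ~ C (t0 *: d').
    apply: (@open_nbhs_nbhs _ d (( *:%R t0) @^-1` (~` C))); split=> //.
    by apply: open_comp (closed_openC closedC) => d' _; exact: scaler_continuous.
  near=> d' t => /= Ct; suff : C (t0 *: d') by near: d'.
  have t_gt0 : 0 < t by near: t; apply: nbhs_pinfty_gt; exact: num_real.
  have t0_le : t0 <= t by near: t; apply: nbhs_pinfty_ge; exact: num_real.
  have -> : t0 *: d' = (t0 / t) *: (t *: d') by rewrite scalerA divfK ?gt_eqF.
  by apply: starC => //; rewrite divr_ge0 ?ler_pdivrMr ?mul1r ?(ltW t_gt0).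
suff : \forall M \near +oo, forall x, C x -> `|x| <= M by [].
near=> M => x Cx; rewrite leNgt; apply/negP => xM.
have M_gt0 : 0 < M by near: M; apply: nbhs_pinfty_gt; exact: num_real.
have x_gt0 : 0 < `|x| by exact: lt_trans xM.
have /(_ (`|x|^-1 *: x)) : S `<=` [set d | ~ C (M *: d)] by near: M.
apply; first by rewrite /S /= normrZ normfV normr_id mulVf ?gt_eqF.
rewrite scalerA; apply: starC => //.
by rewrite divr_ge0 ?ler_pdivrMr ?mul1r ?ltW.
Unshelve. all: by end_near. Qed.

Lemma continuous_meval n (L : {mpoly R[n]}) :
  continuous (fun x : 'rV[R]_n => L.@[x 0]).
Proof.
elim/mpoly_alg_ind: L => [c|i|p q hp hq|p q hp hq] x.
- by under eq_fun do rewrite mevalC; exact: cst_continuous.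
- by under eq_fun do rewrite mevalXU; exact: coord_continuous.
- by under eq_fun do rewrite mevalD; apply: continuousD; [exact: hp | exact: hq].
- by under eq_fun do rewrite mevalM; apply: continuousM; [exact: hp | exact: hq].
Qed.

Lemma closed_sublevel_meval n (L : {mpoly R[n]}) (c : R) :
  closed [set x : 'rV[R]_n | L.@[x 0] <= c].
Proof.
apply: (@preimage_closed _ _ (fun x : 'rV[R]_n => L.@[x 0]) [set t | t <= c]).
  by move=> x _; exact: continuous_meval.
exact: closed_le.
Qed.

Lemma bounded_sublevel_min n (L : {mpoly R[n]}) (x0 : 'rV[R]_n) :
  bounded_set [set x : 'rV[R]_n | L.@[x 0] <= L.@[x0 0]] ->
  exists a : 'I_n -> R, forall x, L.@[a] <= L.@[x].
Proof.
set C := (X in bounded_set X) => boundedC.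
have [||a aC a_min] := @EVT_min_rV R n (fun x => L.@[x 0]) C _
    (bounded_closed_compact boundedC (@closed_sublevel_meval n L _)).
- by exists x0; rewrite /C /=.
- by apply: continuous_subspaceT => x; exact: continuous_meval.
exists (a 0) => x; have -> : L.@[x] = L.@[(\row_i x i) 0].
  by apply: meval_eq => i; rewrite mxE.
have [xC|/ltW xC] := leP L.@[(\row_i x i) 0] L.@[x0 0].
  by apply: a_min; rewrite inE.
by apply: le_trans xC; move: aC; rewrite inE.
Qed.

Lemma convex_const_along n (L : {mpoly R[n]}) (d : 'I_n -> R) (A B : R) :
  convex_fun (fun x => L.@[x]) -> (forall x, A <= L.@[x]) ->
  (forall t, 0 <= t -> L.@[fun i => t * d i] <= B) ->
  forall x t, L.@[fun i => x i + t * d i] = L.@[x].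
Proof.
move=> convL L_ge L_le x t; have [h hE] := meval_line L x d.
have /size1_polyC hC : (size h <= 1)%N.
  apply: (@bounded_poly_size_le1 _ _ A (2^-1 * L.@[fun i => 2 * x i] + (1 - 2^-1) * B)).
  move=> s s0; rewrite hE L_ge /=.
  (* [x + s d] is the midpoint of [2 x] and [2 s d]. *)
  have /= := convL (fun i => 2 * x i) (fun i => 2 * s * d i) 2^-1.
  rewrite (@meval_eq _ _ _ (fun i => x i + s * d i)) => [cvx|i]; last by field.
  apply: le_trans (cvx _ _) _; [lra|lra|].
  by rewrite lerD2l ler_wpM2l ?L_le; lra.
transitivity h.[0]; first by rewrite -hE hC !hornerC.
by rewrite hE; apply: meval_eq => i; rewrite mul0r addr0.
Qed.

Definition insert0 n (i : 'I_n.+1) (y : 'I_n -> R) : 'I_n.+1 -> R :=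
  fun k => oapp y 0 (unlift i k).

Lemma meval_insert0 n (i : 'I_n.+1) (L : {mpoly R[n.+1]}) :
  exists L' : {mpoly R[n]}, forall y, L'.@[y] = L.@[insert0 i y].
Proof.
exists (L \mPo [tuple oapp (fun j => 'X_j) 0 (unlift i k) | k < n.+1]) => y.
rewrite comp_mpoly_meval; apply: meval_eq => k; rewrite tnth_mktuple /insert0.
by case: (unlift i k) => [j|] /=; rewrite ?mevalXU ?meval0.
Qed.

Lemma convex_fun_insert0 n (i : 'I_n.+1) (phi : ('I_n.+1 -> R) -> R) :
  convex_fun phi -> convex_fun (fun y => phi (insert0 i y)).
Proof.
move=> cphi x y t t0 t1; apply: le_trans (cphi _ _ t t0 t1).
rewrite (_ : insert0 i _ = fun k => t * insert0 i x k + (1 - t) * insert0 i y k) //.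
by apply/funext => k; rewrite /insert0; case: unlift => //=; rewrite !mulr0 addr0.
Qed.

(* If a sublevel set is unbounded, the polynomial is constant along a direction
   of recession of it, and a variable occurring in that direction can be set to
   zero. *)
Lemma convex_mpoly_min n (L : {mpoly R[n]}) (A : R) :
  convex_fun (fun x => L.@[x]) -> (forall x, A <= L.@[x]) ->
  exists a, forall x, L.@[a] <= L.@[x].
Proof.
elim: n L => [|n IHn] L convL L_ge.
  by exists (fun _ => 0) => x; rewrite (@meval_eq _ _ _ x) // => -[].
pose C := [set x : 'rV[R]_n.+1 | L.@[x 0] <= L.@[(0 : 'rV[R]_n.+1) 0]].
have [/bounded_sublevel_min//|unboundedC] := pselect (bounded_set C).
have [||d /rV0Pn[i di] d_rec] := recession_direction _ _ unboundedC.
- exact: closed_sublevel_meval.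
- move=> x t; rewrite /C /= => Cx /andP[t0 t1].
  rewrite (@meval_eq _ _ _ (fun k => t * x 0 k + (1 - t) * (0 : 'rV[R]_n.+1) 0 k)).
    by apply: le_trans (convL _ _ t t0 t1) _; nra.
  by move=> k; rewrite !mxE mulr0 addr0.
have L_const x t : L.@[fun k => x k + t * d 0 k] = L.@[x].
  apply: (convex_const_along (B := L.@[(0 : 'rV[R]_n.+1) 0]) convL L_ge) => s s0.
  by rewrite (@meval_eq _ _ _ ((s *: d) 0)) => [|k]; [exact: d_rec | rewrite mxE].
have [L' L'E] := meval_insert0 i L.
have [||a' a'_min] := IHn L'.
- by under eq_fun do rewrite L'E; exact: (@convex_fun_insert0 _ i (fun x => L.@[x])).
- by move=> y; rewrite L'E.
exists (insert0 i a') => x; pose z k := x k + - (x i / d 0 i) * d 0 k.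
have zE : z =1 insert0 i (fun j => z (lift i j)).
  move=> k; rewrite /insert0; case: unliftP => [j ->|->] //=.
  by rewrite /z mulNr divfK // subrr.
by rewrite -(L_const x (- (x i / d 0 i))) (meval_eq L zE) -!L'E.
Qed.

End ConvexPolynomialMinimum.

Section SumsOfSquares.
Context (R : realType) (n : nat).
Implicit Types (s : {mpoly R[n]}).

Lemma sos_mpolyC r (c : R) : 0 <= c -> sos_mpoly r (c%:MP : {mpoly R[n]}).
Proof.
move=> c0; exists 1%N, (fun _ => (Num.sqrt c)%:MP); split=> [i|]; first exact: mdeg_leC.
by rewrite big_ord1 -rmorphXn /= sqr_sqrtr.
Qed.

Lemma sos_mpolyD r s1 s2 :
  sos_mpoly r s1 -> sos_mpoly r s2 -> sos_mpoly r (s1 + s2).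
Proof.
move=> [k [p [rp ->]]] [l [q [rq ->]]]; exists (k + l)%N, (ord_cat p q).
split; last by rewrite (sum_ord_cat p q (fun h => h ^+ 2)).
exact: (@ord_cat_forall _ _ _ p q (fun h => mdeg_le h r)).
Qed.

Lemma sos_mpoly_sum r (I : Type) (t : seq I) (F : I -> {mpoly R[n]}) :
  (forall i, sos_mpoly r (F i)) -> sos_mpoly r (\sum_(i <- t) F i).
Proof.
move=> Fr; apply: (big_ind (@sos_mpoly R n r)) => //; last exact: sos_mpolyD.
by rewrite -mpolyC0; exact: sos_mpolyC.
Qed.

Lemma sos_mpoly_mtranslate r a s : sos_mpoly r s -> sos_mpoly r (mtranslate a s).
Proof.
move=> [k [q [rq ->]]]; exists k, (fun i => mtranslate a (q i)); split=> [i|].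
  exact: mdeg_le_mtranslate.
by rewrite rmorph_sum; apply: eq_bigr => i _; rewrite rmorphXn.
Qed.

Lemma sos_mpoly_ray r s (d : 'I_n -> R) : sos_mpoly r s -> s@_0%MM = 0 ->
  exists K : {poly R}, forall t, s.@[fun i => t * d i] = t ^+ 2 * K.[t].
Proof.
move=> [k [q [_ ->]]]; rewrite raddf_sum /= => s0.
have q0 i : (q i)@_0%MM = 0.
  move/eqP: s0; rewrite psumr_eq0 => [/allP/(_ i (mem_index_enum _))|l _] /=.
    by rewrite expr2 rmorphM /= mulf_eq0 orbb => /eqP.
  by rewrite expr2 rmorphM /= -expr2 sqr_ge0.
have /choice[h hE] i := meval_ray d (q0 i).
exists (\sum_i h i ^+ 2) => t; rewrite raddf_sum horner_sum mulr_sumr /=.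
by apply: eq_bigr => i _; rewrite rmorphXn /= hE horner_exp exprMn.
Qed.

End SumsOfSquares.

Section RadialIntegral.
Context (R : realType) (n : nat).
Implicit Types (p h : {mpoly R[n]}).

(* On the part of [p] of degree at least 2, this is the integral over [0, 1] of
   [(1 - s) * s ^- 2 * p (s x)]; the affine part goes to 0 because [0^-1 = 0]. *)
Definition radial_integral p : {mpoly R[n]} :=
  \sum_(m : 'X_{1..n < msize p}) ((mdeg m * (mdeg m).-1)%:R^-1 * p@_m) *: 'X_[m].

Lemma mcoeff_radial_integral p m :
  (radial_integral p)@_m = (mdeg m * (mdeg m).-1)%:R^-1 * p@_m.
Proof.
have [pm|pm] := ltnP (mdeg m) (msize p).
  by rewrite (mcoeff_mpoly (fun m => (mdeg m * (mdeg m).-1)%:R^-1 * p@_m)).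
rewrite (memN_msupp_eq0 (msize_mdeg_ge pm)) mulr0 raddf_sum big1 // => k _ /=.
rewrite mcoeffZ mcoeffX; case: eqP => [km|_]; last by rewrite mulr0.
by move: (bmdeg k); rewrite km ltnNge pm.
Qed.

Lemma radial_integral_sum k (F : 'I_k -> {mpoly R[n]}) :
  radial_integral (\sum_i F i) = \sum_i radial_integral (F i).
Proof.
apply/mpolyP => m; rewrite mcoeff_radial_integral !raddf_sum /= mulr_sumr.
by apply: eq_bigr => i _; rewrite mcoeff_radial_integral.
Qed.

Lemma radial_weights r : exists w : 'I_r.+1 -> nat -> R, forall a b,
  (0 < a <= r.+1)%N -> (0 < b <= r.+1)%N ->
  \sum_t w t a * w t b = ((a + b) * (a + b).-1)%:R^-1.
Proof.
have [B BE] := psd_gram (psd_radial_mx R r.+1).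
exists (fun t a => B t (inord a.-1)) => -[//|a] [//|b] /= ar br.
have := congr1 (fun M : 'M_r.+1 => M (inord a) (inord b)) BE.
rewrite !mxE !inordK // addSn addnS mulnC => ->.
by apply: eq_bigr => t _; rewrite mxE.
Qed.

(* Scaling the part of [h] of degree [a] by [w t a] turns the weights of the
   radial integral into a sum over [t]. *)
Lemma sos_radial_integral_sqr r h :
  mdeg_le h r -> h@_0%MM = 0 -> sos_mpoly r (radial_integral (h ^+ 2)).
Proof.
move=> /mdeg_leP hr h0; have [w wE] := radial_weights r.
pose q t := \sum_(m : 'X_{1..n < r.+1}) (w t (mdeg m) * h@_m) *: 'X_[m].
have qr t : mdeg_le (q t) r.
  apply: mdeg_le_sum => m _; apply/mdeg_leZ/mdeg_leX.
  by rewrite -ltnS bmdeg.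
have qE t m : (q t)@_m = w t (mdeg m) * h@_m.
  have [mr|mr] := ltnP (mdeg m) r.+1.
    by rewrite (mcoeff_mpoly (fun m => w t (mdeg m) * h@_m)).
  by rewrite hr // mulr0; move/mdeg_leP: (qr t); apply.
have h_supp m : h@_m != 0 -> (0 < mdeg m <= r.+1)%N.
  move=> hm; apply/andP; split.
    by rewrite lt0n mdeg_eq0; apply: contraNneq hm => ->; rewrite h0.
  by apply: leqW; rewrite leqNgt; apply: contraNN hm => /hr ->.
exists r.+1, q; split=> //; apply/mpolyP => m.
rewrite mcoeff_radial_integral raddf_sum expr2 mcoeffM mulr_sumr /=.
under [RHS]eq_bigr => t _ do rewrite expr2 mcoeffM.
rewrite exchange_big; apply: eq_bigr => k /eqP mE /=.
under [RHS]eq_bigr => t _ do rewrite !qE mulrACA.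
rewrite -mulr_suml; have [->|h1] := eqVneq h@_k.1 0; first by rewrite mul0r !mulr0.
have [->|h2] := eqVneq h@_k.2 0; first by rewrite !mulr0.
by rewrite wE ?h_supp // -mdegD -mE.
Qed.

End RadialIntegral.

Section SOSConvexTaylor.
Context (R : realType) (n : nat).
Implicit Types (p : {mpoly R[n]}).

Definition affine_part p : {mpoly R[n]} :=
  (p@_0%MM)%:MP + \sum_j p@_U_(j) *: 'X_j.

Lemma mcoeff_affine_part p m :
  (affine_part p)@_m = if (mdeg m <= 1)%N then p@_m else 0.
Proof.
rewrite mcoeffD mcoeffC raddf_sum /=; under eq_bigr do rewrite mcoeffZ mcoeffX.
case dm: (mdeg m) => [|[|e]] /=.
- have /eqP-> : m == 0%MM by rewrite -mdeg_eq0 dm.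
  by rewrite eqxx mulr1 big1 ?addr0 // => j _; rewrite mnm1_eq0 mulr0.
- have /mdeg1P[j /eqP->] : mdeg m == 1%N by rewrite dm.
  rewrite mnm1_eq0 mulr0 add0r (bigD1 j) //= eqxx mulr1 big1 ?addr0 // => i ij.
  by rewrite eq_mnm1 (negPf ij) mulr0.
- rewrite -mdeg_eq0 dm mulr0 add0r big1 // => j _.
  by case: eqP => [jm|_]; rewrite ?mulr0 //; move: dm; rewrite -jm mdeg1.
Qed.

Lemma quad_form_hessian p :
  quad_form (hessian p) (\col_i 'X_i) = euler (euler p) - euler p.
Proof.
rewrite quad_formE; apply/eqP; rewrite eq_sym subr_eq; apply/eqP.
rewrite {1}/euler -big_split /=; apply: eq_bigr => i _.
rewrite /euler raddf_sum mulr_sumr /=.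
under eq_bigr => j _ do rewrite mderivM mderivXU mulrDr.
rewrite big_split addrC /=; congr (_ + _).
  rewrite (bigD1 i) //= eqxx mul1r big1 ?addr0 // => j /negPf ->.
  by rewrite mul0r mulr0.
by apply: eq_bigr => j _; rewrite !mxE mulrA.
Qed.

(* Taylor's formula: the remainder at [x] is the integral over [0, 1] of
   [(1 - s) * x^T H(s x) x], where [H] is the Hessian of [p]. *)
Lemma sub_affine_partE p :
  p - affine_part p = radial_integral (quad_form (hessian p) (\col_i 'X_i)).
Proof.
apply/mpolyP => m; rewrite mcoeffB mcoeff_affine_part mcoeff_radial_integral.
rewrite quad_form_hessian mcoeffB !mcoeff_euler.
case: (mdeg m) => [|[|d]] /=; first by rewrite mul0n invr0 mul0r subrr.
  by rewrite muln0 invr0 mul0r subrr.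
rewrite subr0 (_ : _ - _ = (d.+2 * d.+1)%:R * p@_m); first by rewrite mulKf ?pnatr_eq0.
by rewrite natrM -[d.+2%:R]natr1; ring.
Qed.

Lemma sos_convex_sub_affine_part r p :
  sos_convex p -> mdeg_le p (2 * r) -> sos_mpoly r (p - affine_part p).
Proof.
move=> [k [F hessE]] pr; pose q l := (F *m \col_i 'X_i) l 0.
have formE : quad_form (hessian p) (\col_i 'X_i) = \sum_l q l ^+ 2.
  by rewrite hessE quad_form_gram.
have q0 l : (q l)@_0%MM = 0.
  rewrite /q mxE raddf_sum big1 //= => i _.
  by rewrite rmorphM /= mxE mcoeffX mnm1_eq0 mulr0.
have qr : forall l, mdeg_le (q l) r.
  apply: mdeg_le_sum_sqr; apply/mdeg_leP => m rm.
  rewrite -formE quad_form_hessian mcoeffB !mcoeff_euler.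
  by rewrite (iffLR (mdeg_leP _ _) pr) // !mulr0 subrr.
rewrite sub_affine_partE formE radial_integral_sum; apply: sos_mpoly_sum => l.
exact: sos_radial_integral_sqr.
Qed.

End SOSConvexTaylor.

Section SOSConvexCone.
Context (R : realType) (n : nat).
Implicit Types (p q : {mpoly R[n]}).

Lemma sos_convexC (c : R) : sos_convex (c%:MP : {mpoly R[n]}).
Proof.
by exists 0%N, 0; apply/matrixP => i j; rewrite !mxE big_ord0 mderivC mderiv0.
Qed.

Lemma sos_convexD p q : sos_convex p -> sos_convex q -> sos_convex (p + q).
Proof.
move=> [k [F hessp]] [l [G hessq]]; exists (k + l)%N, (col_mx F G).
rewrite tr_col_mx mul_row_col -hessp -hessq.
by apply/matrixP => i j; rewrite !mxE !mderivD.
Qed.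

Lemma sos_convexZ (c : R) p : 0 <= c -> sos_convex p -> sos_convex (c *: p).
Proof.
move=> c0 [k [F hessp]]; exists k, ((Num.sqrt c)%:MP *: F).
rewrite [_^T]linearZ /= -scalemxAl -scalemxAr scalerA -hessp -mpolyCM -expr2.
rewrite sqr_sqrtr //.
by apply/matrixP => i j; rewrite !mxE !mderivZ mul_mpolyC.
Qed.

Lemma sos_convex_mtranslate a p : sos_convex p -> sos_convex (mtranslate a p).
Proof.
move=> [k [F hessp]]; exists k, (map_mx (mtranslate a) F).
rewrite map_trmx -map_mxM -hessp.
by apply/matrixP => i j; rewrite !mxE !mderiv_mtranslate.
Qed.

End SOSConvexCone.

Section UnivariateEmbedding.
Context (R : realType) (n : nat).
Implicit Types (q : {poly R}) (j : 'I_n) (u : 'I_n -> {poly R}).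

Lemma horner_map_mpolyC j q k : (size q <= k)%N ->
  (map_poly (@mpolyC n R) q).['X_j] = \sum_(l < k) q`_l *: 'X_j ^+ l.
Proof.
move=> qk; rewrite (horner_coef_wide _ (leq_trans (size_poly _ _) qk)).
by apply: eq_bigr => l _; rewrite coef_map /= mul_mpolyC.
Qed.

Lemma univ_embE j q : univ_emb j q = (map_poly (@mpolyC n R) q).['X_j].
Proof. by rewrite (horner_map_mpolyC _ (leqnn _)). Qed.

Fact univ_emb_is_zmod_morphism j : zmod_morphism (@univ_emb R n j).
Proof. by move=> p q; rewrite !univ_embE rmorphB hornerD hornerN. Qed.

Fact univ_emb_is_monoid_morphism j : monoid_morphism (@univ_emb R n j).
Proof.
by split=> [|p q]; rewrite !univ_embE ?rmorph1 ?hornerC // rmorphM hornerM.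
Qed.

Lemma univ_embC j (c : R) : univ_emb j c%:P = c%:MP.
Proof. by rewrite univ_embE map_polyC hornerC. Qed.

Fact univ_emb_is_scalable j : scalable (@univ_emb R n j).
Proof.
move=> c q; rewrite -mul_polyC (univ_emb_is_monoid_morphism j).2.
by rewrite univ_embC mul_mpolyC.
Qed.

HB.instance Definition _ j := GRing.isZmodMorphism.Build {poly R} {mpoly R[n]}
  (@univ_emb R n j) (univ_emb_is_zmod_morphism j).
HB.instance Definition _ j := GRing.isMonoidMorphism.Build {poly R} {mpoly R[n]}
  (@univ_emb R n j) (univ_emb_is_monoid_morphism j).
HB.instance Definition _ j := GRing.isScalable.Build R {poly R} {mpoly R[n]} *:%R
  (@univ_emb R n j) (univ_emb_is_scalable j).

Lemma univ_embX j : univ_emb j 'X = 'X_j :> {mpoly R[n]}.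
Proof. by rewrite univ_embE map_polyX hornerX. Qed.

Lemma meval_univ_emb j q x : (univ_emb j q).@[x] = q.[x j].
Proof.
elim/poly_ind: q => [|q c IHq]; first by rewrite rmorph0 meval0 horner0.
rewrite rmorphD rmorphM /= univ_embX univ_embC mevalD mevalM mevalXU mevalC IHq.
by rewrite !hornerE.
Qed.

Lemma mtranslate_univ_emb a j q :
  mtranslate a (univ_emb j q) = univ_emb j (q \Po ('X + (a j)%:P)).
Proof.
elim/poly_ind: q => [|q c IHq]; first by rewrite comp_poly0 !rmorph0.
rewrite comp_polyD comp_polyM comp_polyX comp_polyC !rmorphD !rmorphM /= IHq.
by rewrite rmorphD /= univ_embX !univ_embC mtranslateXU mtranslateC.
Qed.

Lemma mdeg_le_univ_emb j q k : (size q <= k.+1)%N -> mdeg_le (univ_emb j q) k.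
Proof.
move=> qk; apply: mdeg_le_sum => i _; apply: mdeg_leZ; rewrite mpolyXn.
by apply: mdeg_leX; rewrite mdegMn mdeg1 mul1n -ltnS (leq_trans (ltn_ord i)).
Qed.

Lemma sep_polyD u w : sep_poly (fun j => u j + w j) = sep_poly u + sep_poly w.
Proof. by rewrite -big_split; apply: eq_bigr => j _; rewrite rmorphD. Qed.

Lemma sep_polyZ (c : R) u : sep_poly (fun j => c *: u j) = c *: sep_poly u.
Proof. by rewrite scaler_sumr; apply: eq_bigr => j _; rewrite linearZ. Qed.

Lemma mtranslate_sep_poly a u :
  mtranslate a (sep_poly u) = sep_poly (fun j => u j \Po ('X + (a j)%:P)).
Proof.
by rewrite rmorph_sum; apply: eq_bigr => j _; rewrite /= mtranslate_univ_emb.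
Qed.

End UnivariateEmbedding.

Section ConvexUnivariate.
Context (R : realType).
Implicit Types (q s w : {poly R}).

Lemma convex_upolyP q :
  convex_upoly q <-> convex_fun (fun x : 'I_1 -> R => q.[x ord0]).
Proof.
split=> cq x y t t0 t1; first exact: cq.
exact: cq (fun _ => x) (fun _ => y) t t0 t1.
Qed.

Lemma convex_upolyD q s : convex_upoly q -> convex_upoly s -> convex_upoly (q + s).
Proof.
move=> /convex_upolyP cq /convex_upolyP cs; apply/convex_upolyP.
by under eq_fun do rewrite hornerD; exact: convex_funD cq cs.
Qed.

Lemma convex_upolyZ (c : R) q : 0 <= c -> convex_upoly q -> convex_upoly (c *: q).
Proof.
move=> c0 /convex_upolyP cq; apply/convex_upolyP.
by under eq_fun do rewrite hornerZ; exact: convex_funZ c0 cq.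
Qed.

Lemma convex_upoly_affine (b c : R) : convex_upoly (b *: 'X + c%:P).
Proof. by move=> x y t _ _; rewrite !hornerE; lra. Qed.

Lemma convex_upoly_shift q (a : R) :
  convex_upoly q -> convex_upoly (q \Po ('X + a%:P)).
Proof.
move=> /convex_upolyP cq; apply/convex_upolyP.
under eq_fun do rewrite horner_comp hornerD hornerX hornerC.
exact: convex_fun_shift (fun _ => a) cq.
Qed.

Lemma convex_upoly_nonneg w (K : {poly R}) :
  convex_upoly w -> w.[0] = 0 -> (forall t, 0 <= w.[t] + t ^+ 2 * K.[t]) ->
  forall t, 0 <= w.[t].
Proof.
move=> cw w0 wK t; pose h := w.[t]%:P + 'X * (t ^+ 2 *: (K \Po (t *: 'X))).
have hE e : h.[e] = w.[t] + e * (t ^+ 2 * K.[e * t]).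
  by rewrite /h !hornerE horner_comp !hornerE [t * e]mulrC.
suff : 0 <= h.[0] by rewrite hE mul0r addr0.
apply: (@horner_ge0_right _ _ _ 1) => // e /andP[e_gt0 e_lt1].
rewrite hE -(pmulr_rge0 _ e_gt0); have := wK (e * t).
by have := cw t 0 e (ltW e_gt0) (ltW e_lt1); rewrite w0 !mulr0 !addr0; lra.
Qed.

End ConvexUnivariate.

Section SPLDPolynomials.
Context (R : realType) (n r : nat) (d : 'I_n -> nat).
Implicit Types (f h p : {mpoly R[n]}).

Definition spld_convex h : Prop :=
  convex_fun (fun x => h.@[x]) /\
  exists (w : 'I_n -> {poly R}) p,
    [/\ forall j, convex_upoly (w j) /\ (size (w j) <= (2 * d j).+1)%N,
        sos_convex p, mdeg_le p (2 * r) & h = sep_poly w + p].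

Definition spld_sos h : Prop :=
  exists (sigma : {mpoly R[n]}) (sig : 'I_n -> {poly R}),
    [/\ sos_mpoly r sigma, forall j, sos_upoly (d j) (sig j) &
        h = sigma + \sum_(j < n) univ_emb j (sig j)].

Lemma spld_convexC (c : R) : spld_convex c%:MP.
Proof.
split; first by under eq_fun do rewrite mevalC; exact: convex_fun_cst.
exists (fun _ => 0), c%:MP; split; [|exact: sos_convexC|exact: mdeg_leC|].
  by move=> j; rewrite size_poly0; split=> // x y t _ _; rewrite !horner0 !mulr0 addr0.
by rewrite /sep_poly big1 ?add0r // => j _; rewrite rmorph0.
Qed.

Lemma spld_convexD f h : spld_convex f -> spld_convex h -> spld_convex (f + h).
Proof.
move=> [cf [u [p [hu cp dp fE]]]] [ch [w [q [hw cq dq hE]]]]; split.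
  by under eq_fun do rewrite mevalD; exact: (convex_funD cf ch).
exists (fun j => u j + w j), (p + q); split.
- move=> j; have [[cu su] [cw sw]] := (hu j, hw j); split; first exact: convex_upolyD.
  by rewrite (leq_trans (size_polyD _ _)) // geq_max su.
- exact: sos_convexD.
- exact: mdeg_leD.
- by rewrite sep_polyD fE hE addrACA.
Qed.

Lemma spld_convexZ (c : R) h : 0 <= c -> spld_convex h -> spld_convex (c *: h).
Proof.
move=> c0 [ch [w [p [hw cp dp hE]]]]; split.
  by under eq_fun do rewrite mevalZ; exact: (convex_funZ c0 ch).
exists (fun j => c *: w j), (c *: p); split.
- move=> j; have [cw sw] := hw j; split; first exact: convex_upolyZ.
  exact: leq_trans (size_scale_leq _ _) sw.
- exact: sos_convexZ.
- exact: mdeg_leZ.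
- by rewrite sep_polyZ hE scalerDr.
Qed.

Lemma spld_convex_mtranslate a h : spld_convex h -> spld_convex (mtranslate a h).
Proof.
move=> [ch [w [p [hw cp dp hE]]]]; split.
  by under eq_fun do rewrite meval_mtranslate; exact: (convex_fun_shift a ch).
exists (fun j => w j \Po ('X + (a j)%:P)), (mtranslate a p); split.
- move=> j; have [cw sw] := hw j; split; first exact: convex_upoly_shift.
  by rewrite size_comp_poly2 ?size_XaddC.
- exact: sos_convex_mtranslate.
- exact: mdeg_le_mtranslate.
- by rewrite hE rmorphD /= mtranslate_sep_poly.
Qed.

Lemma leq_d0 j : (d j <= d0 d)%N.
Proof. exact: leq_bigmax. Qed.

Lemma mdeg_le_spld_convex h :
  (r <= d0 d)%N -> spld_convex h -> mdeg_le h (2 * d0 d).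
Proof.
move=> rd [_ [w [p [hw _ dp ->]]]]; apply: mdeg_leD.
  apply: mdeg_le_sum => j _; apply: mdeg_le_univ_emb.
  by rewrite (leq_trans (hw j).2) // ltnS leq_mul2l leq_d0.
by apply: mdeg_leW dp; rewrite leq_mul2l.
Qed.

Lemma spld_sos_mtranslate a h : spld_sos h -> spld_sos (mtranslate a h).
Proof.
move=> [sigma [sig [s0 sig0 ->]]].
exists (mtranslate a sigma), (fun j => sig j \Po ('X + (a j)%:P)); split.
- exact: sos_mpoly_mtranslate.
- by move=> j; exact: sos_upoly_shift.
- rewrite rmorphD rmorph_sum; congr (_ + _).
  by apply: eq_bigr => j _; rewrite /= mtranslate_univ_emb.
Qed.

Lemma spld_convex_expansion h : spld_convex h ->
  exists (v : 'I_n -> {poly R}) (s : {mpoly R[n]}),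
    [/\ forall j, [/\ convex_upoly (v j), (v j).[0] = 0 &
          (size (v j) <= (2 * d j).+2)%N],
        sos_mpoly r s, s@_0%MM = 0 &
        h = (h@_0%MM)%:MP + s + \sum_j univ_emb j (v j)].
Proof.
move=> [_ [w [p [hw cp dp hE]]]]; pose s := p - affine_part p.
pose v j := w j + (p@_U_(j) *: 'X + (- (w j).[0])%:P).
have v0 j : (v j).[0] = 0.
  by rewrite !hornerD hornerZ hornerX hornerC mulr0 add0r subrr.
have s0 : s@_0%MM = 0 by rewrite mcoeffB mcoeff_affine_part mdeg0 subrr.
exists v, s; split=> //.
- move=> j; have [cw sw] := hw j; split=> //.
    by apply: convex_upolyD; [exact: cw | exact: convex_upoly_affine].
  rewrite (leq_trans (size_polyD _ _)) // geq_max (leq_trans sw) //=.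
  rewrite (leq_trans (size_polyD _ _)) // geq_max.
  rewrite (leq_trans (size_scale_leq _ _)) ?size_polyX //.
  by rewrite (leq_trans (size_polyC_leq1 _)).
- exact: sos_convex_sub_affine_part.
- have {}hE : h = (\sum_j (w j).[0] + p@_0%MM)%:MP + s + \sum_j univ_emb j (v j).
    rewrite hE /s /affine_part /sep_poly mpolyCD rmorph_sum /= /v.
    under [X in _ = _ + X]eq_bigr do
      rewrite !rmorphD /= linearZ /= univ_embX univ_embC rmorphN /=.
    by rewrite !big_split sumrN /=; ring.
  have v_sum0 : (\sum_j univ_emb j (v j))@_0%MM = 0.
    by rewrite raddf_sum big1 // => j _; rewrite /= -meval_at0 meval_univ_emb v0.
  rewrite {1}hE; congr (_%:MP + _ + _).
  by rewrite hE 2!mcoeffD mcoeffC eqxx mulr1 s0 v_sum0 !addr0.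
Qed.

(* Along the axes the minimum makes [v j] dominate [- t ^+ 2 * K.[t]], hence
   nonnegative by convexity. *)
Lemma spld_sos_min_at0 h : spld_convex h ->
  (forall x, h@_0%MM <= h.@[x]) -> 0 <= h@_0%MM -> spld_sos h.
Proof.
move=> /spld_convex_expansion[v [s [hv sos_s s0 hE]]] h_min h_ge0.
exists ((h@_0%MM)%:MP + s), v; split=> // [|j].
  by apply: sos_mpolyD => //; exact: sos_mpolyC.
have [cv v0 sv] := hv j; apply: nonneg_poly_sos => //.
have [K KE] := sos_mpoly_ray (fun l => (l == j)%:R) sos_s s0.
apply: (@convex_upoly_nonneg _ (v j) K) => // t.
have := h_min (fun l => t * (l == j)%:R); rewrite {2}hE !mevalD mevalC KE -addrA lerDl.
rewrite addrC raddf_sum /= (bigD1 j) //= big1.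
  by rewrite meval_univ_emb eqxx mulr1 addr0.
by move=> l lj; rewrite meval_univ_emb (negPf lj) mulr0; have [_ ->] := hv l.
Qed.

Lemma spld_nonneg_sos h :
  spld_convex h -> (forall x, 0 <= h.@[x]) -> spld_sos h.
Proof.
move=> spld_h h_ge0; have [a a_min] := convex_mpoly_min spld_h.1 h_ge0.
rewrite -(mtranslateNK a h); apply/spld_sos_mtranslate/spld_sos_min_at0.
- exact: spld_convex_mtranslate.
- by move=> x; rewrite mcoeff0_mtranslate meval_mtranslate.
- by rewrite mcoeff0_mtranslate.
Qed.

End SPLDPolynomials.

Section Moments.
Context (R : realType) (n D : nat) (y : 'X_{1..n < D.+1} -> R).

Fact Lfun_is_linear : linear_for *%R (Lfun y).
Proof.
move=> c p q; rewrite /Lfun mulr_sumr -big_split; apply: eq_bigr => i _.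
by rewrite mcoeffD mcoeffZ mulrDl mulrA.
Qed.

HB.instance Definition _ :=
  GRing.isLinear.Build R {mpoly R[n]} R *%R (Lfun y) Lfun_is_linear.

Lemma LfunC (c : R) : Lfun y c%:MP = c * y bm0.
Proof.
rewrite /Lfun (bigD1 bm0) //= mcoeffC eqxx mulr1 big1 ?addr0 // => i.
by rewrite bmeqP /= mcoeffC => /negPf ->; rewrite mulr0 mul0r.
Qed.

Lemma quad_form_moment_mx k (v : 'I_k -> {mpoly R[n]}) (c : 'cV[R]_k) :
  quad_form (moment_mx y v) c = Lfun y ((\sum_i c i 0 *: v i) ^+ 2).
Proof.
rewrite quad_formE expr2 mulr_suml raddf_sum; apply: eq_bigr => i _.
rewrite mulr_sumr raddf_sum; apply: eq_bigr => j _ /=.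
by rewrite mxE -[in RHS]scalerAl -[in RHS]scalerAr !linearZ /= mulrA.
Qed.

Lemma psd_moment_mx_sqr_ge0 k (v : 'I_k -> {mpoly R[n]}) (c : 'I_k -> R) :
  psd (moment_mx y v) -> 0 <= Lfun y ((\sum_i c i *: v i) ^+ 2).
Proof.
move=> [_ /(_ (\col_i c i))]; rewrite -/(quad_form _ _) quad_form_moment_mx.
by under eq_bigr do rewrite mxE.
Qed.

Lemma Lfun_sos_mpoly_ge0 r s :
  psd (moment_mx y (@mono_vec R n r)) -> sos_mpoly r s -> 0 <= Lfun y s.
Proof.
move=> yr [k [q [qr ->]]]; rewrite raddf_sum sumr_ge0 // => i _.
rewrite (mpolywE (qr i)) (reindex (@enum_val _ {: 'X_{1..n < r.+1}})) /=.
  exact: (psd_moment_mx_sqr_ge0 (fun l => (q i)@_(bmnm (enum_val l)))).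
exact: onW_bij (enum_val_bij _).
Qed.

Lemma Lfun_sos_upoly_ge0 j d s :
  psd (moment_mx y (@var_pow_vec R n j d)) -> sos_upoly d s ->
  0 <= Lfun y (univ_emb j s).
Proof.
move=> yd [k [q [qd ->]]]; rewrite [univ_emb _ _]raddf_sum raddf_sum sumr_ge0 // => i _.
rewrite /= rmorphXn /= univ_embE (horner_map_mpolyC _ (qd i)).
exact: (psd_moment_mx_sqr_ge0 (fun l => (q i)`_l)).
Qed.

End Moments.

Section PointMoments.
Context (R : realType) (n D : nat) (x : 'I_n -> R).

Definition point_moments (m : 'X_{1..n < D.+1}) : R := \prod_i x i ^+ bmnm m i.

Lemma Lfun_point_moments p : mdeg_le p D -> Lfun point_moments p = p.@[x].
Proof.
move=> pD; rewrite {2}(mpolywE pD) raddf_sum; apply: eq_bigr => m _.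
by rewrite /= mevalZ mevalX.
Qed.

Lemma psd_point_moments k (v : 'I_k -> {mpoly R[n]}) :
  (forall i j, mdeg_le (v i * v j) D) -> psd (moment_mx point_moments v).
Proof.
move=> vD; split=> [|c]; first by apply/matrixP => i j; rewrite !mxE mulrC.
rewrite -/(quad_form _ _) quad_form_moment_mx Lfun_point_moments.
  by rewrite rmorphXn sqr_ge0.
rewrite expr2 mulr_suml; apply: mdeg_le_sum => i _.
rewrite mulr_sumr; apply: mdeg_le_sum => j _.
by rewrite -scalerAl -scalerAr; do 2!apply: mdeg_leZ.
Qed.

End PointMoments.

Section Duality.
Context (R : realType) (n m r : nat) (d : 'I_n -> nat)
        (f : {mpoly R[n]}) (g : 'I_m -> {mpoly R[n]}).

Definition lagrangian (lam : 'I_m -> R) (v : R) : {mpoly R[n]} :=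
  f + \sum_(i < m) lam i *: g i - v%:MP.

Lemma meval_lagrangian lam v x :
  (lagrangian lam v).@[x] = f.@[x] + \sum_i lam i * (g i).@[x] - v.
Proof.
rewrite /lagrangian mevalB mevalD mevalC raddf_sum; congr (_ + _ - _).
by apply: eq_bigr => i _; rewrite /= mevalZ.
Qed.

Lemma spld_convex_lagrangian lam v : (forall i, 0 <= lam i) ->
  spld_convex r d f -> (forall i, spld_convex r d (g i)) ->
  spld_convex r d (lagrangian lam v).
Proof.
move=> lam0 hf hg; rewrite /lagrangian -mpolyCN.
apply: spld_convexD; last exact: spld_convexC.
apply: spld_convexD => //; apply: (big_ind (spld_convex r d)).
- by rewrite -mpolyC0; exact: spld_convexC.
- exact: spld_convexD.
- by move=> i _; exact: spld_convexZ.
Qed.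

Lemma D_feasibleP mu : D_feasible r d f g mu <->
  exists lam, (forall i, 0 <= lam i) /\ spld_sos r d (lagrangian lam mu).
Proof.
split=> [[lam [sigma [sig [lam0 s0 sig0 E]]]]|[lam [lam0 [sigma [sig [s0 sig0 E]]]]]].
  by exists lam; split=> //; exists sigma, sig.
by exists lam, sigma, sig.
Qed.

Lemma D_feasible_le_Dt_values mu z :
  D_feasible r d f g mu -> Dt_values r d f g z -> mu <= z.
Proof.
move=> [lam [sigma [sig [lam0 s0 sig0 LE]]]] [y [yg yd yr y1 ->]].
have : 0 <= Lfun y (lagrangian lam mu).
  rewrite /lagrangian LE raddfD raddf_sum /= addr_ge0 ?(Lfun_sos_mpoly_ge0 yr s0) //.
  by apply: sumr_ge0 => j _; exact: Lfun_sos_upoly_ge0 (yd j) (sig0 j).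
rewrite raddfB raddfD raddf_sum /= LfunC y1 mulr1.
have : \sum_i Lfun y (lam i *: g i) <= 0.
  by apply: sumr_le0 => i _; rewrite linearZ mulr_ge0_le0 ?yg.
lra.
Qed.

Lemma CP_values_Dt_values z : (r <= d0 d)%N ->
  mdeg_le f (2 * d0 d) -> (forall i, mdeg_le (g i) (2 * d0 d)) ->
  CP_values f g z -> Dt_values r d f g z.
Proof.
move=> rd fd gd [x [gx ->]]; exists (@point_moments R n (2 * d0 d) x); split.
- by move=> i; rewrite Lfun_point_moments.
- move=> j; apply: psd_point_moments => a b; rewrite /var_pow_vec -exprD mpolyXn.
  apply: mdeg_leX; rewrite mdegMn mdeg1 mul1n mul2n -addnn.
  by apply: leq_add; apply: leq_trans (leq_d0 d j); rewrite -ltnS.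
- apply: psd_point_moments => a b; rewrite mul2n -addnn.
  by apply: mdeg_leM; apply: mdeg_leX; apply: leq_trans rd; rewrite -ltnS bmdeg.
- by rewrite /point_moments big1 // => i _; rewrite mnm0E expr0.
- by rewrite Lfun_point_moments.
Qed.

Lemma spld_strong_duality v :
  spld_convex r d f -> (forall i, spld_convex r d (g i)) ->
  (exists x, forall i, (g i).@[x] < 0) ->
  (forall z, CP_values f g z -> v <= z) -> D_feasible r d f g v.
Proof.
move=> hf hg slater v_le; apply/D_feasibleP.
have [i|x gx|lam [lam0 lamP]] := lagrange_multipliers (v := v) hf.1 _ slater.
- exact: (hg i).1.
- by apply: v_le; exists x.
exists lam; split=> //; apply: spld_nonneg_sos; first exact: spld_convex_lagrangian.
by move=> x; rewrite meval_lagrangian subr_ge0.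
Qed.

End Duality.

Theorem theorem4 (R : realType) (n m r : nat) (d : 'I_n -> nat)
    (u0 : 'I_n -> {poly R}) (p0 : {mpoly R[n]})
    (u : 'I_m -> 'I_n -> {poly R}) (p : 'I_m -> {mpoly R[n]}) :
  let f := sep_poly u0 + p0 in
  let g := fun i => sep_poly (u i) + p i in
  (forall j, convex_upoly (u0 j) /\ (size (u0 j) <= (2 * d j).+1)%N) ->
  (forall i j, convex_upoly (u i j) /\ (size (u i j) <= (2 * d j).+1)%N) ->
  sos_convex p0 /\ mdeg_le p0 (2 * r) ->
  (forall i, sos_convex (p i) /\ mdeg_le (p i) (2 * r)) ->
  convex_fun (fun x => f.@[x]) ->
  (forall i, convex_fun (fun x => (g i).@[x])) ->
  (r < d0 d)%N ->
  (exists c : R, forall x, CP_feasible g x -> c <= f.@[x]) ->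
  (exists xh, CP_feasible g xh /\ forall i, (g i).@[xh] < 0) ->
  exists v : R,
    [/\ is_inf (CP_values f g) v,
        is_sup (D_feasible r d f g) v,
        is_inf (Dt_values r d f g) v &
        D_feasible r d f g v].
Proof.
move=> f g hu0 hu [cp0 dp0] hp cf cg /ltnW rd [c f_ge] [xh [xhF slater]].
have spld_f : spld_convex r d f by split=> //; exists u0, p0.
have spld_g i : spld_convex r d (g i).
  by have [cp dp] := hp i; split=> //; exists (u i), (p i).
have [v v_inf] : exists v, is_inf (CP_values f g) v.
  apply: (@is_inf_exists _ _ c) => [|_ [x [xF ->]]]; last exact: f_ge.
  by exists f.@[xh], xh.
have v_feasible : D_feasible r d f g v.
  by apply: spld_strong_duality v_inf.1 => //; exists xh.
have [sup_D inf_Dt] : is_sup (D_feasible r d f g) v /\ is_inf (Dt_values r d f g) v.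
  apply: is_sup_is_inf_squeeze v_inf _ _ v_feasible => [z|mu z].
    by apply: CP_values_Dt_values => // [|i]; exact: (mdeg_le_spld_convex (r := r)).
  exact: D_feasible_le_Dt_values.
by exists v.
Qed.
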